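(* For any positive integers $n \ge k \ge 1$, $$\chi_b(\widehat{SS}(n,k)) = n-k+1.$$ Moreover, for any vertex $A$ of $\widehat{SS}(n,k)$, the signed graph $\widehat{SS}(n,k)-A$ (obtained by deleting $A$) admits a balanced $(n-k)$-colouring.
   Context: A signed graph $(G,\sigma)$ is a graph $G$ (loops and parallel edges allowed) with a signature $\sigma: E(G)\to\{-1,+1\}$; an edge $e$ is positive if $\sigma(e)=+1$ and negative if $\sigma(e)=-1$. Switching a vertex $v$ means flipping the signs of all non-loop edges incident with $v$. Two signatures on the same graph are switching equivalent if one is obtained from the other by a sequence of vertex switchings. $(G,\sigma)$ is balanced if it is switching equivalent to the signature that is constantly positive. A set $X\subseteq V(G)$ is balanced if the signed subgraph induced by $X$ is balanced. A balanced $p$-colouring of $(G,\sigma)$ is a map $f:V(G)\to[p]=\{1,\dots,p\}$ such that $f^{-1}(i)$ is a balanced set for each $i\in[p]$; the balanced chromatic number $\chi_b(G,\sigma)$ is the minimum $p$ such that $(G,\sigma)$ has a balanced $p$-colouring. By convention the signed graph with no vertices admits a balanced $0$-colouring. Write $\pm[n]=\{\pm1,\dots,\pm n\}$ and $-A=\{-a:a\in A\}$. A signed $k$-subset of $[n]$ is a $k$-element subset $A$ of $\pm[n]$ with $A\cap(-A)=\emptyset$. The Kneser signed graph $KS(n,k)$ has as vertices all signed $k$-subsets of $[n]$; vertices $A,B$ are joined by a positive edge if $A\cap(-B)=\emptyset$, and are joined by a negative edge if $A\cap B=\emptyset$ (so two vertices may be joined by two parallel edges of opposite signs; each vertex carries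 a positive loop, which is irrelevant to balance). A signed $k$-subset is alternating if it has the form $\{a_1,-a_2,\dots,(-1)^{k-1}a_k\}$ or $\{-a_1,a_2,\dots,(-1)^k a_k\}$ with $1\le a_1<a_2<\dots<a_k\le n$. The Schrijver signed graph $SS(n,k)$ is the signed subgraph of $KS(n,k)$ induced by the alternating signed $k$-subsets. $\widehat{SS}(n,k)$ is the signed subgraph of $SS(n,k)$ induced by those vertices whose element of smallest absolute value is positive, i.e. the sets of the form $\{a_1,-a_2,\dots,(-1)^{k-1}a_k\}$ with $1\le a_1<\dots<a_k\le n$. *)

(* Defs.v *)
From mathcomp Require Import all_boot.
Set Implicit Arguments.
Unset Strict Implicit.
Unset Printing Implicit Defensive.

(* Multigraph with loops: the ends of an edge form a set of one vertex (a loop)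
   or two vertices. The sign of an edge is [true] iff the edge is negative, so
   that b stands for (-1) ^ b. *)
Record sgraph := SGraph {
  vert :> finType;
  edge : finType;
  ends : edge -> {set vert};
  ends_card : forall e, 0 < #|ends e| <= 2;
  sgn : edge -> bool }.

Section SignedGraph.
Variable G : sgraph.

Definition is_loop (e : edge G) : bool := #|ends e| == 1.

Definition switch (sigma : edge G -> bool) (v : G) : edge G -> bool :=
  fun e => if (v \in ends e) && ~~ is_loop e then ~~ sigma e else sigma e.

Definition switching_equivalent (sigma tau : edge G -> bool) : Prop :=
  exists s : seq G, foldl switch sigma s =1 tau.

Definition balanced : Prop := switching_equivalent (@sgn G) (fun _ => false).

End SignedGraph.

Section Induced.
Variables (G : sgraph) (X : {set G}).

Definition ind_vert : finType := {v : G | v \in X}.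
Definition ind_edge : finType := {e : edge G | ends e \subset X}.
Definition ind_ends (e : ind_edge) : {set ind_vert} :=
  [set v | val v \in ends (val e)].
Definition ind_sgn (e : ind_edge) : bool := sgn (val e).

Fact ind_ends_card (e : ind_edge) : 0 < #|ind_ends e| <= 2.
Proof.
rewrite -(card_imset _ val_inj).
suff -> : val @: ind_ends e = ends (val e) by exact: ends_card.
apply/setP=> v; apply/imsetP/idP => [[w + ->]|vE]; first by rewrite inE.
by exists (Sub v (subsetP (valP e) _ vE)); rewrite ?inE SubK.
Qed.

Definition induced : sgraph := SGraph ind_ends_card ind_sgn.

Definition balanced_set : Prop := balanced induced.

End Induced.

Definition delete (G : sgraph) (v : G) : sgraph := induced [set~ v].
Arguments delete : clear implicits.

Definition balanced_colouring (G : sgraph) (p : nat) (f : G -> 'I_p) : Prop :=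
  forall i : 'I_p, balanced_set (f @^-1: [set i]).

Definition balanced_colourable (G : sgraph) (p : nat) : Prop :=
  exists f : G -> 'I_p, balanced_colouring f.

(* "The balanced chromatic number of G exists and is p" rather than a function
   of G, as a signed graph with a negative loop has no balanced colouring. *)
Definition is_chi_b (G : sgraph) (p : nat) : Prop :=
  balanced_colourable G p /\ forall q, balanced_colourable G q -> p <= q.

Section Kneser.
Variables n k : nat.

(* The pair (b, i) stands for (-1) ^ b * (i + 1), an element of {+-1, ..., +-n};
   its absolute value is thus ordered as i. *)
Definition pm : finType := (bool * 'I_n)%type.
Definition pm_opp (x : pm) : pm := (~~ x.1, x.2).
Definition set_opp (A : {set pm}) : {set pm} := pm_opp @: A.

Definition signed_subset (A : {set pm}) : bool :=
  (#|A| == k) && (A :&: set_opp A == set0).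

Definition KS_vert : finType := {A : {set pm} | signed_subset A}.

Definition KS_adj (b : bool) (A B : KS_vert) : bool :=
  if b then val A :&: val B == set0 else val A :&: set_opp (val B) == set0.

(* At most one edge of each sign between A and B (including A = B). *)
Definition KS_edge : finType :=
  {e : {set KS_vert} * bool |
    [exists A, exists B, (e.1 == [set A; B]) && KS_adj e.2 A B]}.
Definition KS_ends (e : KS_edge) : {set KS_vert} := (val e).1.
Definition KS_sgn (e : KS_edge) : bool := (val e).2.

Fact KS_ends_card (e : KS_edge) : 0 < #|KS_ends e| <= 2.
Proof.
have /existsP[A /existsP[B /andP[/eqP eAB _]]] := valP e.
by rewrite /KS_ends eAB cards2; case: (A != B).
Qed.

Definition KS : sgraph := SGraph KS_ends_card KS_sgn.

(* With indices starting at 0, the i-th element in absolute value has sign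
   (-1) ^ (b + i). *)
Definition alternating_from (b : bool) (A : {set pm}) : bool :=
  [exists a : {ffun 'I_k -> 'I_n},
     [forall i : 'I_k, forall j : 'I_k, (i < j) ==> (a i < a j)]
       && (A == [set (b (+) odd i, a i) | i : 'I_k])].

Definition alternating (A : {set pm}) : bool :=
  alternating_from false A || alternating_from true A.

Definition SS : sgraph := induced [set A : KS | alternating (val A)].

Definition least_positive (A : {set pm}) : bool :=
  [exists x in A, ~~ x.1 && [forall y in A, x.2 <= y.2]].

Definition SShat : sgraph :=
  induced [set A : SS | least_positive (val (val A))].

End Kneser.

(* Main.v *)
Require Import Defs.
From mathcomp Require Import all_boot fingroup perm.

Set Implicit Arguments.
Unset Strict Implicit.
Unset Printing Implicit Defensive.

(** A balanced colouring is the same thing as a colour [f v] and a sign [t v]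
    for every vertex such that an edge between two vertices of one colour is
    positive or negative according as their signs agree or differ
    ([balanced_colourableP]).

    Upper bounds. For a coordinate c, the vertices that contain c or -c form a
    balanced set: take the sign of c in A as the sign of A. Two sets that agree
    in that sign meet, hence are not joined by a negative edge; two sets that
    disagree are not joined by a positive edge. Hence a set J of coordinates
    that every vertex hits yields a colouring with #|J| colours
    ([star_colouring]). Any n - k + 1 coordinates are hit by every k-set. The
    n - k coordinates outside A are hit by every vertex other than A, because a
    vertex is determined by its coordinates: its signs must alternate, starting
    with + ([coords_inj]).

    Lower bound. A colouring with q colours gives an antipodal labelling of the
    nonempty signed subsets X of {1, ..., n} by {+-1, ..., +-(k - 1 + q)}. If X
    or -X contains a vertex v, then X gets the label k + f v (colours being
    counted from 0), with the sign t v, reversed in case v lies in -X.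
    Otherwise the longest alternating subset of X has fewer than k elements,
    and its size, with the sign of its first element, is the label. Nested sets
    never get opposite labels: for the labels of the second kind since the two
    maximal lengths of alternation, starting with + and with -, differ and are
    monotone in X; for those of the first kind since two vertices inside Y or
    -Y are adjacent, with a sign that forces their labels to agree. The
    octahedral Tucker lemma ([octahedral_tucker]) now says n <= k - 1 + q.

    Tucker's lemma is proved by Fan's parity argument. Maximal chains of signed
    sets are encoded by signed permutations. The number of maximal chains on
    the first d coordinates whose labels, ordered by absolute value, alternate
    in sign starting with - is odd, by induction on d: the chains on d + 1
    coordinates that contain the element + of the last coordinate form a
    hemisphere bounded by the sphere on d coordinates. Count the pairs of a
    chain in the hemisphere and a level whose deletion leaves labels that
    alternate starting with -. Chain by chain, the parity of this number is
    that of the alternating chains of the hemisphere with either starting sign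
    ([alt_labels_delete]), that is, by antipodality, of the chains of the whole
    sphere that alternate starting with -. Ridge by ridge, interior ridges lie
    in two chains and cancel, so that only those of the boundary count
    ([odd_ridge_pairs]). For d = n there is a chain with n labels of distinct
    absolute values. *)

(** * Balance as a two-valued potential *)

(** The only access to edges in what follows: it survives nested induced
    subgraphs ([adj_induced]), whose edge types are iterated sigma types. *)
Definition adj (G : sgraph) (b : bool) (u v : G) : Prop :=
  exists2 e : edge G, ends e = [set u; v] & sgn e = b.

(** Switching a vertex twice cancels, so only the parity of the number of
    switched ends matters. *)
Lemma foldl_switch (G : sgraph) (s : seq G) (sigma : edge G -> bool) e :
  foldl (@switch G) sigma s e =
  sigma e (+) (~~ is_loop e && odd (count (mem (ends e)) s)).
Proof.
elim: s sigma => [|v s IHs] sigma /=; first by rewrite andbF addbF.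
rewrite IHs /switch oddD; case: (v \in ends e) => /=; last by [].
by case: (is_loop e); case: (sigma e); case: (odd _).
Qed.

Lemma count_mem_pair (T : finType) (u v : T) (s : seq T) :
  u != v -> count (mem [set u; v]) s = count_mem u s + count_mem v s.
Proof.
move=> neq_uv; rewrite -count_predUI [X in _ = _ + X](eq_count (a2 := pred0)).
  by rewrite count_pred0 addn0; apply: eq_count => x; rewrite !inE.
by move=> x /=; apply: contraNF neq_uv => /andP[/eqP<- /eqP<-].
Qed.

Lemma endsE (G : sgraph) (e : edge G) : exists u v, ends e = [set u; v].
Proof.
have /andP[] := ends_card e; rewrite leq_eqVlt => /orP[|gt1 le2].
  by rewrite eq_sym => /cards1P[u ->] _; exists u, u; rewrite setUid.
have /cards2P[u [v [_ ->]]] : #|ends e| == 2 by rewrite eqn_leq le2.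
by exists u, v.
Qed.

(** The potential [t] marks the vertices that are switched an odd number of
    times. On a loop the equation makes the sign positive, as it must be since
    switching leaves loops alone. *)
Lemma balancedP (G : sgraph) :
  balanced G <->
  exists t : G -> bool, forall b u v, adj b u v -> b = t u (+) t v.
Proof.
split=> [[s sE]|[t tE]].
  exists (fun v => odd (count_mem v s)) => _ u v [e eE <-].
  move: (sE e); rewrite foldl_switch eE /is_loop eE cards2.
  have [<-|neq_uv] /= := eqVneq u v; first by rewrite addbF addbb.
  by rewrite count_mem_pair // oddD; case: (sgn e); case: (odd (count_mem u s));
    case: (odd _).
exists (enum [set v | t v]) => e; rewrite foldl_switch.
have [u [v eE]] := endsE e.
rewrite (tE _ u v (ex_intro2 _ _ e eE erefl)) /is_loop eE cards2.
have [->|neq_uv] /= := eqVneq u v; first by rewrite addbb.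
rewrite count_mem_pair // !count_uniq_mem ?enum_uniq //.
by rewrite !mem_enum !inE oddD !oddb addbb.
Qed.

Lemma adj_induced (G : sgraph) (X : {set G}) b (u v : induced X) :
  adj b u v <-> adj b (val u) (val v).
Proof.
split=> [[e eE <-]|[e eE <-]].
  exists (val e) => //; apply/setP=> w; rewrite !inE.
  have [wX|wX] := boolP (w \in X); last first.
    rewrite (negbTE (contra (subsetP (valP e) w) wX)).
    case: eqVneq wX => [->|_]; first by rewrite (valP u).
    by case: eqVneq => [->|//]; rewrite (valP v).
  have := congr1 (fun S : {set induced X} => (Sub w wX : induced X) \in S) eE.
  rewrite !inE SubK => ->.
  by rewrite -!val_eqE.
have eX : ends e \subset X by rewrite eE subUset !sub1set (valP u) (valP v).
exists (Sub e eX : ind_edge X); last by rewrite /= /ind_sgn SubK.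
by apply/setP=> w; rewrite !inE SubK eE !inE !val_eqE.
Qed.

Lemma balanced_colourableP (G : sgraph) p :
  balanced_colourable G p <->
  exists (f : G -> 'I_p) (t : G -> bool),
    forall b u v, adj b u v -> f u = f v -> b = t u (+) t v.
Proof.
split=> [[f fE]|[f [t tE]]]; last first.
  exists f => i; apply/balancedP; exists (fun v => t (val v)) => b u v.
  move/adj_induced/tE; apply.
  by have := valP u; have := valP v; rewrite !inE => /eqP-> /eqP->.
have /fin_all_exists[t tE] (i : 'I_p) : exists t : {ffun G -> bool},
  forall b u v, adj b u v -> f u = i -> f v = i -> b = t u (+) t v.
  have /balancedP[t tE] := fE i.
  exists [ffun v => if insub v is Some w then t w else false].
  move=> b u v uv fu fv.
  have uX : u \in f @^-1: [set i] by rewrite !inE fu.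
  have vX : v \in f @^-1: [set i] by rewrite !inE fv.
  by rewrite !ffunE !insubT; apply/tE/adj_induced.
exists f, (fun v => t (f v) v) => b u v uv fuv.
by rewrite fuv; apply: tE uv _ _.
Qed.

(** * Antipodes and signed sets *)

Section SetOpp.
Variable n : nat.
Implicit Types X Y A B : {set pm n}.

Definition signed (X : {set pm n}) : bool := X :&: set_opp X == set0.

Lemma pm_oppK : involutive (@pm_opp n).
Proof. by move=> [b i]; rewrite /pm_opp negbK. Qed.

Lemma in_set_opp X (x : pm n) : (x \in set_opp X) = (pm_opp x \in X).
Proof.
by rewrite -{1}[x]pm_oppK mem_imset //; apply: inv_inj pm_oppK.
Qed.

Lemma signedP X :
  reflect (forall b c, (b, c) \in X -> (~~ b, c) \notin X) (signed X).
Proof.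
apply: (iffP eqP) => [X0 b c bc|XP].
  by apply/negP=> nbc; have := in_set0 (b, c); rewrite -X0 inE bc in_set_opp nbc.
apply/setP=> -[b c]; rewrite !inE in_set_opp.
by apply/andP=> -[/XP/negbTE bc]; rewrite bc.
Qed.

Lemma set_oppK : involutive (@set_opp n).
Proof. by move=> X; apply/setP=> x; rewrite !in_set_opp pm_oppK. Qed.

Lemma signed_opp X : signed (set_opp X) = signed X.
Proof. by rewrite /signed set_oppK setIC. Qed.

Lemma signed_sub X Y : X \subset Y -> signed Y -> signed X.
Proof.
move=> /subsetP sXY /signedP sY; apply/signedP=> b c /sXY/sY.
by apply: contra => /sXY.
Qed.

Lemma set_oppS X Y : (set_opp X \subset set_opp Y) = (X \subset Y).
Proof.
apply/subsetP/subsetP=> sXY x; last by rewrite !in_set_opp => /sXY.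
by have := sXY (pm_opp x); rewrite !in_set_opp pm_oppK.
Qed.

Lemma set_opp_eq0 X : (set_opp X == set0) = (X == set0).
Proof. by rewrite -!subset0 -[in LHS](imset0 (@pm_opp n)) set_oppS. Qed.

Lemma set_oppI X Y : set_opp (X :&: Y) = set_opp X :&: set_opp Y.
Proof. by apply/setP=> x; rewrite inE !in_set_opp inE. Qed.

Lemma signed_disjoint X A B :
  signed X -> A \subset X -> B \subset set_opp X -> A :&: B == set0.
Proof.
by move=> /eqP X0 sAX sBX; rewrite -subset0 -X0 setISS.
Qed.

End SetOpp.

(** * Parity of alternating label sequences *)

(** The elements split into pairs {x, f x}. *)
Lemma even_card_involution (T : finType) (f : T -> T) (A : {set T}) :
  (forall x, x \in A -> [/\ f x \in A, f (f x) = x & f x != x]) -> ~~ odd #|A|.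
Proof.
have [m] := ubnP #|A|; elim: m A => // m IHm A leAm fA.
have [->|[x xA]] := set_0Vmem A; first by rewrite cards0.
have [fxA ffx neq] := fA x xA.
have fxAx : f x \in A :\ x by rewrite !inE neq.
rewrite (cardsD1 x) xA (cardsD1 (f x) (A :\ x)) fxAx /= negbK.
apply: IHm.
  move: leAm; rewrite (cardsD1 x) xA (cardsD1 (f x) (A :\ x)) fxAx /=.
  by rewrite ltnS => /ltnW.
move=> y; rewrite !inE => /and3P[yfx yx yA]; have [fyA ffy fyy] := fA y yA.
split=> //; rewrite fyA andbT; apply/andP; split.
  by apply: contra yx => /eqP/(congr1 f); rewrite ffy ffx => ->.
by apply: contra yfx => /eqP<-; rewrite ffy.
Qed.

Fixpoint alternates (b : bool) (s : seq bool) : bool :=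
  if s is x :: s' then (x == b) && alternates (~~ b) s' else true.

(** This is the coboundary formula behind Fan's lemma: modulo 2, the number of
    deletions that leave a sequence alternating from b is 1 if the sequence
    itself alternates, from either sign, and 0 otherwise. A sequence with one
    repetition is repaired by deleting either of the two equal neighbours. *)
Lemma alternates_delete (I : eqType) (sg : I -> bool) b (s : seq I) :
  uniq s -> s != [::] ->
  \big[addb/false]_(i <- s) alternates b [seq sg j | j <- s & j != i] =
  alternates b (map sg s) (+) alternates (~~ b) (map sg s).
Proof.
elim: s b => // x s IHs b /andP[xs uns] _; rewrite big_cons /= eqxx /=.
have -> : [seq j <- s | j != x] = s.
  by apply/all_filterP/allP=> j js; apply: contraNneq xs => <-.
have -> : \big[addb/false]_(i <- s)
    alternates b [seq sg j | j <- if x != i then x :: [seq j <- s | j != i]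
                                  else [seq j <- s | j != i]] =
  (sg x == b) && \big[addb/false]_(i <- s)
    alternates (~~ b) [seq sg j | j <- s & j != i].
  rewrite big_distrr /=; apply: eq_big_seq => i si.
  by rewrite ifT //; apply: contraNneq xs => ->.
have [->|s0] := eqVneq s [::]; first by rewrite big_nil; case: (sg x); case: b.
by rewrite IHs // negbK; case: (sg x); case: b;
   case: (alternates true _); case: (alternates false _).
Qed.

(** A sign, [true] for -, and an absolute value. *)
Definition label : Type := (bool * nat)%type.
Definition label_opp (l : label) : label := (~~ l.1, l.2).

Definition abs_le (l l' : label) : bool := l.2 <= l'.2.
Lemma abs_le_trans : transitive abs_le.
Proof. by move=> x y z; apply: leq_trans. Qed.

Lemma abs_le_total : total abs_le.
Proof. by move=> x y; apply: leq_total. Qed.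

Definition alt_labels (b : bool) (ls : seq label) : bool :=
  alternates b [seq l.1 | l <- sort abs_le ls].

(** Sorting is stable, so it commutes with the deletion of an index even when
    several labels share an absolute value. *)
Lemma alt_labels_delete (I : eqType) (f : I -> label) b (s : seq I) :
  uniq s -> s != [::] ->
  \big[addb/false]_(i <- s) alt_labels b [seq f j | j <- s & j != i] =
  alt_labels b (map f s) (+) alt_labels (~~ b) (map f s).
Proof.
move=> uns s0; pose r := relpre f abs_le.
have altE c (s' : seq I) :
    alt_labels c (map f s') = alternates c [seq (f i).1 | i <- sort r s'].
  by rewrite /alt_labels sort_map -map_comp.
have perm_s : perm_eq (sort r s) s by rewrite perm_sort.
rewrite !altE -alternates_delete ?sort_uniq //; last first.
  by rewrite -size_eq0 size_sort size_eq0.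
rewrite (perm_big _ perm_s); apply: eq_bigr => i _.
rewrite altE filter_sort //.
  by move=> x y; apply: abs_le_total.
by move=> x y z; apply: abs_le_trans.
Qed.

Lemma alt_labels_opp b (ls : seq label) :
  alt_labels b (map label_opp ls) = alt_labels (~~ b) ls.
Proof.
rewrite /alt_labels sort_map -map_comp.
change (sort (relpre label_opp abs_le) ls) with (sort abs_le ls).
elim: (sort _ _) b => //= l s IHs b.
by rewrite IHs; case: l.1; case: b.
Qed.

(** Labels with a common absolute value that are neighbours in the sorted
    sequence would have different signs, hence be opposite. So the absolute
    values are distinct. *)
Lemma size_alt_labels_le (m : nat) b (ls : seq label) :
  {in ls &, forall l l', l' <> label_opp l} -> {in ls, forall l, l.2 < m} ->
  alt_labels b ls -> size ls <= m.
Proof.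
move=> noopp ltm; rewrite /alt_labels -(size_sort abs_le).
have : sorted abs_le (sort abs_le ls) by apply/sort_sorted/abs_le_total.
have {noopp} : {in sort abs_le ls &, forall l l', l' <> label_opp l}.
  by move=> l l'; rewrite !mem_sort; apply: noopp.
have {ltm} : {in sort abs_le ls, forall l, l.2 < m}.
  by move=> l; rewrite mem_sort; apply: ltm.
move: (sort _ _) => {}ls ltm noopp sorted_ls alt_ls.
have : sorted ltn (map snd ls).
  case: ls {ltm} noopp sorted_ls alt_ls => //= l ls; elim: ls l b => //= l' ls IHls.
  move=> l b noopp /andP[le_ll' pls] /and3P[/eqP lE /eqP l'E alt_ls].
  apply/andP; split; last first.
    apply: (IHls l' (~~ b)) => //; last by rewrite l'E eqxx.
    by move=> x y xl yl; apply: noopp; rewrite inE ?xl ?yl orbT.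
  rewrite ltn_neqAle [_ <= _]le_ll' andbT; apply/eqP=> eq_abs.
  apply: (noopp l l'); rewrite ?inE ?eqxx ?orbT //.
  by case: l l' lE l'E eq_abs {noopp le_ll' pls alt_ls} => [c x] [c' y] /= -> -> ->.
move/(sorted_uniq ltn_trans ltnn)=> uniq_abs.
rewrite -(size_map snd) -(size_iota 0 m); apply: uniq_leq_size => // _ /mapP[l ll ->].
by rewrite mem_iota /= ltm.
Qed.

(** * The octahedral Tucker lemma *)

Section Tucker.
Variable n : nat.
Implicit Types (X Y : {set pm n}) (e : {ffun 'I_n -> bool}).

Let chain : finType := ({perm 'I_n} * {ffun 'I_n -> bool})%type.
Implicit Types g : chain.

(** The chain of the signed permutation g adds the coordinates in the order of
    their ranks [g.1 c], each with the sign [g.2 c]; [level g r] is its member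
    with r + 1 elements. *)
Definition level (g : chain) (r : nat) : {set pm n} :=
  [set x : pm n | (x.1 == g.2 x.2) && (g.1 x.2 <= r)].

Definition flip (P : pred 'I_n) e : {ffun 'I_n -> bool} := [ffun c => P c (+) e c].

(** The maximal chains on the first d coordinates, continued in the standard
    way by the positive elements d, d + 1, ... so that spheres of all dimensions
    share one type of chains. *)
Definition in_sphere (d : nat) g : bool :=
  [forall c : 'I_n, (d <= c) ==> (g.1 c == c) && ~~ g.2 c].

Variable lam : {set pm n} -> label.

Definition labels g (s : seq nat) : seq label := [seq lam (level g r) | r <- s].

Definition alt_chains (d : nat) : {set chain} :=
  [set g | in_sphere d g & alt_labels true (labels g (iota 0 d))].

Lemma signed_level g r : signed (level g r).
Proof.
apply/signedP=> b c; rewrite !inE /= => /andP[/eqP-> _].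
by case: (g.2 c).
Qed.

Hypothesis lam_opp : forall X, X != set0 -> signed X ->
  lam (set_opp X) = label_opp (lam X).

Lemma level_neq0 g r : r < n -> level g r != set0.
Proof.
move=> ltr; apply/set0Pn; pose c := (g.1^-1)%g (Ordinal ltr).
by exists (g.2 c, c); rewrite inE /= eqxx permKV /=.
Qed.

Lemma level_flip g (P : pred 'I_n) r :
  (forall c, g.1 c <= r -> P c) -> level (g.1, flip P g.2) r = set_opp (level g r).
Proof.
move=> sub; apply/setP=> -[b c]; rewrite in_set_opp !inE /= ffunE.
by have [/sub->|] := boolP (g.1 c <= r); rewrite ?andbF // !andbT;
   case: b; case: (g.2 c).
Qed.

Lemma level_flip_id g (P : pred 'I_n) r :
  (forall c, g.1 c <= r -> ~~ P c) -> level (g.1, flip P g.2) r = level g r.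
Proof.
move=> sub; apply/setP=> -[b c]; rewrite !inE /= ffunE.
by have [/sub/negbTE->|] := boolP (g.1 c <= r); rewrite ?andbF.
Qed.

Lemma flip_flip (P : pred 'I_n) e : flip P (flip P e) = e.
Proof. by apply/ffunP=> c; rewrite !ffunE addbA addbb. Qed.

Lemma in_sphere_lt d g c : in_sphere d g -> g.1 c < d -> c < d.
Proof.
move=> /forallP/(_ c)/implyP gd; rewrite [g.1 c < d]ltnNge [c < d]ltnNge.
by apply: contra => dc; have /andP[/eqP-> _] := gd dc.
Qed.

Lemma in_sphere0 : in_sphere 0 =1 pred1 (1%g : {perm 'I_n}, [ffun=> false]).
Proof.
move=> [q e] /=; apply/forallP/eqP => [gE|[-> ->] c]; last first.
  by rewrite perm1 ffunE eqxx.
congr pair; [apply/permP|apply/ffunP] => c; have /andP[/eqP qc ec] := gE c.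
  by rewrite perm1.
by rewrite ffunE (negbTE ec).
Qed.

(** Reversing all signs is a bijection of the sphere that exchanges the two
    kinds of alternating chains. *)
Lemma antipode_chain d g b : d <= n -> in_sphere d g ->
  in_sphere d (g.1, flip (fun c => c < d) g.2) /\
  alt_labels b (labels (g.1, flip (fun c => c < d) g.2) (iota 0 d)) =
  alt_labels (~~ b) (labels g (iota 0 d)).
Proof.
move=> led gd; split.
  apply/forallP=> c; apply/implyP=> lec.
  by have /forallP/(_ c)/implyP/(_ lec) := gd; rewrite ffunE ltnNge lec.
rewrite -alt_labels_opp /labels -map_comp; congr alt_labels; apply/eq_in_map=> r.
rewrite mem_iota /= add0n => ltr.
rewrite level_flip ?lam_opp ?signed_level ?level_neq0 ?(leq_trans ltr) //.
by move=> c le_cr; apply: (in_sphere_lt gd); apply: leq_ltn_trans ltr.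
Qed.

Lemma odd_card_set (T : finType) (A P : pred T) :
  odd #|[set x | A x & P x]| = \big[addb/false]_(x | A x) P x.
Proof.
rewrite -sum1_card (eq_bigl (fun x => A x && P x)) => [|x]; last by rewrite inE.
rewrite (big_morph odd oddD erefl) big_mkcondr.
by apply: eq_bigr => x _; case: (P x).
Qed.

Lemma eq_labels g g' s : {in s, forall r, level g r = level g' r} ->
  labels g s = labels g' s.
Proof. by move=> eq_g; apply/eq_in_map=> r /eq_g->. Qed.

Definition others (d i : nat) : seq nat := [seq r <- iota 0 d.+1 | r != i].

(** A chain of the closed hemisphere on the coordinates up to j, where j has the
    sign +, with a level whose deletion leaves labels alternating from -. *)
Definition ridge_pairs (j : 'I_n) : {set chain * 'I_n} :=
  [set x : chain * 'I_n | [&& in_sphere j.+1 x.1, ~~ x.1.2 j, x.2 <= j &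
    alt_labels true (labels x.1 (others j x.2))]].

(** The ridges on the boundary of the hemisphere: the deleted level is the one
    that brings in the coordinate j. *)
Definition fixed_pair (j : 'I_n) (x : chain * 'I_n) : bool :=
  (x.2 == j) && (x.1.1 j == j).

(** The other chain on the same ridge. Below the top, two consecutive steps of
    the chain are exchanged; at the top, the sign of the last element is
    reversed, which leaves the hemisphere only if that element is j. *)
Definition cross_ridge (j : 'I_n) (x : chain * 'I_n) : chain * 'I_n :=
  if x.2 < j then (((x.1.1 * tperm x.2 (ordS x.2))%g, x.1.2), x.2)
  else ((x.1.1, flip (pred1 ((x.1.1^-1)%g j)) x.1.2), x.2).

Lemma level_tperm g (i i' : 'I_n) (r : nat) : i' = i.+1 :> nat -> r != i ->
  level ((g.1 * tperm i i')%g, g.2) r = level g r.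
Proof.
move=> i'E ri; apply/setP=> -[b c]; rewrite !inE /= permM; congr (_ && _).
have lt_ir : (i' <= r) = (i <= r) by rewrite i'E ltn_neqAle eq_sym ri.
by case: tpermP => [->|->|//]; rewrite lt_ir.
Qed.

Lemma cross_ridgeP j x : x \in ridge_pairs j -> ~~ fixed_pair j x ->
  [/\ cross_ridge j x \in ridge_pairs j, ~~ fixed_pair j (cross_ridge j x),
      cross_ridge j (cross_ridge j x) = x & cross_ridge j x != x].
Proof.
case: x => [[q e] i]; rewrite /cross_ridge /fixed_pair.
rewrite !inE /= => /and4P[qej ej le_ij alt_l] nfix.
have [lt_ij|] := ltnP i j.
  have SiE : ordS i = i.+1 :> nat.
    by rewrite /= modn_small // (leq_ltn_trans lt_ij).
  rewrite -val_eqE /= (ltn_eqF lt_ij) /= lt_ij -mulgA tperm2 mulg1; split=> //.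
    rewrite ej le_ij /=; apply/andP; split.
      apply/forallP=> c; apply/implyP=> lt_jc.
      have /forallP/(_ c)/implyP/(_ lt_jc)/= /andP[/eqP qc ->] := qej.
      have lt_ic : i < c by apply: leq_ltn_trans lt_jc.
      have lt_Sic : ordS i < c by rewrite SiE (leq_ltn_trans lt_ij).
      by rewrite andbT permM qc tpermD // -val_eqE ltn_eqF.
    rewrite (@eq_labels _ (q, e)) // => r; rewrite mem_filter => /andP[ri _].
    exact: (@level_tperm (q, e)).
  apply/eqP=> -[/(congr1 (fun p => (q^-1 * p)%g))]; rewrite mulKg mulVg.
  move/permP/(_ i); rewrite tpermL perm1 => eq_i.
  by move/eqP: SiE; rewrite eq_i eqn_leq ltnn andbF.
move=> le_ji; have /eqP eq_ij : i == j by rewrite -val_eqE eqn_leq le_ij.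
rewrite {}eq_ij {i le_ij le_ji} eqxx /= in nfix alt_l *.
have neqj : (q^-1)%g j != j.
  by apply: contra nfix => /eqP vj; rewrite -{1}vj permKV.
rewrite nfix flip_flip ltnn; split=> //; last first.
  apply/eqP=> -[/ffunP/(_ ((q^-1)%g j))]; rewrite ffunE /= eqxx.
  by case: (e _).
rewrite ffunE /= eq_sym (negbTE neqj) ej leqnn /=; apply/andP; split.
  apply/forallP=> c; apply/implyP=> lt_jc.
  have /forallP/(_ c)/implyP/(_ lt_jc)/= /andP[/eqP qc ec] := qej.
  rewrite qc eqxx ffunE /= (negbTE ec) addbF -(inj_eq (@perm_inj _ q)) permKV qc.
  by rewrite -val_eqE gtn_eqF.
rewrite (@eq_labels _ (q, e)) // => r.
rewrite mem_filter mem_iota ltnS => /and3P[rj _ le_rj].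
apply: (@level_flip_id (q, e)) => c /= le_cr.
rewrite -(inj_eq (@perm_inj _ q)) permKV -val_eqE ltn_eqF //.
by rewrite (leq_ltn_trans le_cr) // ltn_neqAle rj.
Qed.

(** The chains on fewer coordinates are those of the boundary of the
    hemisphere. *)
Lemma in_sphereS (j : 'I_n) g :
  in_sphere j g = [&& in_sphere j.+1 g, ~~ g.2 j & g.1 j == j].
Proof.
apply/forallP/and3P => [gj|[/forallP gSj ej qj] c].
  have := gj j; rewrite leqnn => /andP[-> ->]; split=> //.
  by apply/forallP=> c; apply/implyP=> /ltnW lec; have /implyP := gj c; apply.
apply/implyP; rewrite leq_eqVlt => /orP[/eqP/val_inj<-|]; first by rewrite qj.
exact/implyP.
Qed.

Lemma others_last d : others d d = iota 0 d.
Proof.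
rewrite /others -addn1 iotaD filter_cat /= add0n eqxx cats0.
by apply/all_filterP/allP=> r; rewrite mem_iota => /andP[_ /ltn_eqF->].
Qed.

(** [cross_ridge] pairs off everything but the boundary ridges. *)
Lemma odd_ridge_pairs (j : 'I_n) : odd #|ridge_pairs j| = odd #|alt_chains j|.
Proof.
rewrite -(cardsID [set x | fixed_pair j x] (ridge_pairs j)) oddD.
rewrite [X in _ (+) X](_ : _ = false) ?addbF; last first.
  (* Away from the boundary, ridges cancel in pairs. *)
  apply/negbTE/(@even_card_involution _ (cross_ridge j)) => x.
  rewrite 2!inE => /andP[nfix xT]; have [yT yfix yK ynx] := cross_ridgeP xT nfix.
  by split=> //; rewrite inE yT inE yfix.
have inj_pair : injective (fun g : chain => (g, j)) by move=> g g' [].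
rewrite -(card_imset _ inj_pair); congr odd; apply: eq_card => -[g i].
apply/idP/imsetP => [|[g' + [-> ->]]].
  rewrite !inE /fixed_pair /= => /andP[/and4P[gS gj _ alt_g] /andP[/eqP ij qj]].
  by exists g; rewrite ?ij // inE in_sphereS gS gj qj -others_last -{2}ij.
rewrite !inE in_sphereS => /andP[/and3P[gS gj qj] alt_g].
by rewrite /fixed_pair /= gS gj qj eqxx leqnn others_last alt_g.
Qed.

(** Here the pairs are counted chain by chain. The antipode carries the chains
    of the hemisphere that alternate from + to those of the opposite hemisphere
    that alternate from -. *)
Lemma odd_ridge_pairs_hemisphere (j : 'I_n) :
  odd #|ridge_pairs j| = odd #|alt_chains j.+1|.
Proof.
pose H g := in_sphere j.+1 g && ~~ g.2 j.
pose alt b g := alt_labels b (labels g (iota 0 j.+1)).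
pose alt_others g i := alt_labels true (labels g (others j i)).
have -> : odd #|ridge_pairs j| =
    odd #|[set g | H g & alt true g]| (+) odd #|[set g | H g & alt false g]|.
  have -> : ridge_pairs j = [set x : chain * 'I_n |
      H x.1 && (x.2 < j.+1) & alt_others x.1 x.2].
    by apply/setP=> x; rewrite !inE -!andbA.
  rewrite !odd_card_set -big_split /=.
  rewrite -(pair_big_dep H (fun _ (i : 'I_n) => i < j.+1) alt_others) /=.
  apply: eq_bigr => g _.
  rewrite -(big_ord_widen n (alt_others g)) // -(big_mkord predT (alt_others g)).
  rewrite /index_iota subn0.
  by rewrite -(@alt_labels_delete _ (fun r => lam (level g r)) true) ?iota_uniq.
have antiE g b : in_sphere j.+1 g -> _ := @antipode_chain _ g b (ltn_ord j).
pose anti g : chain := (g.1, flip (fun c : 'I_n => c < j.+1) g.2).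
have antiK : involutive anti by move=> [q e]; rewrite /anti flip_flip.
rewrite -(cardsID [set g : chain | ~~ g.2 j] (alt_chains _)) oddD.
congr (odd _ (+) odd _).
  by apply: eq_card => g; rewrite !inE andbAC.
rewrite -(card_imset _ (inv_inj antiK)); apply: eq_card => g.
rewrite -{1}[g]antiK mem_imset; last exact: inv_inj.
rewrite !inE /H /alt negbK /=.
have [gS|gNS] := boolP (in_sphere j.+1 g).
  have [-> ->] := antiE g false gS; rewrite ffunE leqnn /= negbK andbC.
  by case: (g.2 j).
rewrite andbF; case: andP => // -[/andP[gS' _] _].
by case/negP: gNS; rewrite -[g]antiK; have [] := antiE _ true gS'.
Qed.

Lemma odd_alt_chains d : d <= n -> odd #|alt_chains d|.
Proof.
elim: d => [_|d IHd ltd]; last first.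
  by rewrite -(odd_ridge_pairs_hemisphere (Ordinal ltd)) odd_ridge_pairs IHd 1?ltnW.
rewrite (eq_card (B := [set (1%g : {perm 'I_n}, [ffun=> false])])) ?cards1 // => g.
by rewrite !inE in_sphere0 andbT.
Qed.

(** An odd number is not zero, so there is an alternating maximal chain. *)
Lemma octahedral_tucker m :
  (forall X, X != set0 -> signed X -> (lam X).2 < m) ->
  (forall X Y, X != set0 -> signed Y -> X \subset Y -> lam Y <> label_opp (lam X)) ->
  n <= m.
Proof.
move=> lam_lt lam_edge; have := odd_alt_chains (leqnn n).
case: (set_0Vmem (alt_chains n)) => [->|[g]]; first by rewrite cards0.
rewrite inE => /andP[_ alt_g] _.
rewrite -(size_iota 0 n) -(size_map (fun r => lam (level g r))).
have level_sub r r' : r <= r' -> level g r \subset level g r'.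
  by move=> le_r; apply/subsetP=> x; rewrite !inE => /andP[->] /leq_trans->.
apply: size_alt_labels_le alt_g => [_ _ /mapP[r + ->] /mapP[r' + ->]|_ /mapP[r + ->]].
  rewrite !mem_iota => /= ltr ltr'; have [le_r|/ltnW le_r] := leqP r r'.
    by apply: lam_edge; rewrite ?level_neq0 ?signed_level ?level_sub.
  move=> eq_lam; apply: (lam_edge (level g r') (level g r)).
  - exact: level_neq0.
  - exact: signed_level.
  - exact: level_sub.
  by rewrite eq_lam; case: (lam _) => b i; rewrite /label_opp negbK.
by rewrite mem_iota => ltr; apply: lam_lt; rewrite ?level_neq0 ?signed_level.
Qed.

End Tucker.

(** * Alternating subsets of a signed set *)

Section Alternating.
Variable n : nat.
Implicit Types (s : seq 'I_n) (X Y : {set pm n}).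

Definition increasing s : bool := sorted ltn (map val s).

Fixpoint altseq (b : bool) s : seq (pm n) :=
  if s is c :: s' then (b, c) :: altseq (~~ b) s' else [::].

Definition alt_set b s : {set pm n} := [set x in altseq b s].

Lemma increasing_uniq s : increasing s -> uniq s.
Proof. by move/(sorted_uniq ltn_trans ltnn)/map_uniq. Qed.

Lemma mem_altseq b s x : uniq s ->
  (x \in altseq b s) = (x.2 \in s) && (x.1 == b (+) odd (index x.2 s)).
Proof.
case: x => c i /=; elim: s b => //= h s IHs b /andP[hs uns].
rewrite !inE xpair_eqE IHs // [h == i]eq_sym; have [->|_] /= := eqVneq i h.
  by rewrite (negbTE hs) !andbT orbF addbF.
by rewrite andbF /= addbN addNb.
Qed.

(** Sequences make it possible to prepend or drop an element of an alternating
    set, which is awkward with increasing functions on ordinals. *)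
Lemma alternating_fromP k b X :
  reflect (exists s, [/\ increasing s, size s = k & X = alt_set b s])
          (alternating_from k b X).
Proof.
have altE (t : k.-tuple 'I_n) : uniq t ->
    [set (b (+) odd i, tnth t i) | i : 'I_k] = alt_set b t.
  move=> unt; apply/setP=> x; rewrite inE mem_altseq //.
  have idx i : index (tnth t i) t = i.
    by rewrite (tnth_nth (tnth t i)) index_uniq // size_tuple.
  apply/imsetP/andP=> [[i _ ->]|[/tnthP[i xi] /eqP x1]] /=.
    by rewrite mem_tnth idx.
  by exists i => //; case: x xi x1 => c j /= -> ->; rewrite idx.
have incrE (t : k.-tuple 'I_n) :
    increasing t <-> forall i j : 'I_k, i < j -> tnth t i < tnth t j.
  split=> [inct i j lt_ij|inct].
    have c0 := tnth t i; rewrite !(tnth_nth c0) -!(nth_map c0 0 val) ?size_tuple //.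
    by apply: (sorted_ltn_nth ltn_trans) => //; rewrite inE size_map size_tuple.
  apply/(sortedP 0) => i; rewrite size_map size_tuple => ltSi.
  pose i1 := Ordinal (ltnW ltSi); pose i2 := Ordinal ltSi; pose c0 := tnth t i1.
  have := inct i1 i2 (ltnSn i).
  by rewrite !(tnth_nth c0) !(nth_map c0 0 val) ?size_tuple // ltnW.
apply: (iffP existsP) => [[a /andP[/forallP inca /eqP->]]|[s [incs sz_s ->]]].
  pose t := [tuple a i | i < k]; have inct : increasing t.
    apply/incrE=> i j lt_ij; rewrite !tnth_mktuple.
    by have /forallP/(_ j)/implyP/(_ lt_ij) := inca i.
  exists t; rewrite size_tuple -altE ?increasing_uniq //; split=> //.
  by apply: eq_imset => i; rewrite tnth_mktuple.
pose t := tcast sz_s (in_tuple s); have tE : t = s :> seq _ by rewrite val_tcast.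
exists [ffun i => tnth t i]; apply/andP; split.
  apply/forallP=> i; apply/forallP=> j; apply/implyP=> lt_ij; rewrite !ffunE.
  by apply: (incrE t).1 lt_ij; rewrite tE.
rewrite -tE -altE ?tE ?increasing_uniq //; apply/eqP/eq_imset => i.
by rewrite ffunE.
Qed.

Lemma all_altseq_opp b s X :
  all (mem (set_opp X)) (altseq b s) = all (mem X) (altseq (~~ b) s).
Proof.
by elim: s b => //= c s IHs b; rewrite IHs in_set_opp.
Qed.

Lemma all_altseq_take m b s X :
  all (mem X) (altseq b s) -> all (mem X) (altseq b (take m s)).
Proof. by elim: s b m => [|c s IHs] b [|m] //= /andP[-> /IHs->]. Qed.

Definition alternation b X : nat :=
  \max_(j < n.+1 | [exists t : j.-tuple 'I_n,
     increasing t && all (mem X) (altseq b t)]) j.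

Lemma alternation_ge b X s :
  increasing s -> all (mem X) (altseq b s) -> size s <= alternation b X.
Proof.
move=> incs Xs; have ltn : size s < n.+1.
  rewrite ltnS -(card_uniqP (increasing_uniq incs)).
  by rewrite -[n in _ <= n]card_ord max_card.
apply: (@bigop.leq_bigmax_cond _ _ (fun j : 'I_n.+1 => j : nat) (Ordinal ltn)).
by apply/existsP; exists (in_tuple s); rewrite incs.
Qed.

Lemma alternation_attained b X :
  exists s, [/\ increasing s, all (mem X) (altseq b s) & size s = alternation b X].
Proof.
have [|j /existsP[t /andP[inct Xt]] jE] := @bigop.eq_bigmax_cond _
  [pred j : 'I_n.+1 | [exists t : j.-tuple 'I_n,
     increasing t && all (mem X) (altseq b t)]] (fun j => j : nat).
  by apply/card_gt0P; exists ord0; apply/existsP; exists [tuple].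
by exists t; split=> //; rewrite size_tuple.
Qed.

Lemma alternation_sub b X Y : X \subset Y -> alternation b X <= alternation b Y.
Proof.
move=> /subsetP sXY; have [s [incs Xs <-]] := alternation_attained b X.
by apply: alternation_ge => //; apply: sub_all Xs.
Qed.

Lemma alternation_opp b X : alternation b (set_opp X) = alternation (~~ b) X.
Proof.
by apply: eq_bigl => j; apply: eq_existsb => t; rewrite all_altseq_opp.
Qed.

Lemma alternation_gt0 X : X != set0 -> exists b, 0 < alternation b X.
Proof.
case/set0Pn=> -[b c] bcX; exists b.
by apply: (@alternation_ge b X [:: c]); rewrite //= bcX.
Qed.

(** Of two longest alternating sequences with different first signs and equal
    lengths, the one whose first element comes later could be extended by the
    first element of the other. *)
Lemma alternation_neq X :
  X != set0 -> signed X -> alternation true X != alternation false X.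
Proof.
move=> X0 Xs; apply/eqP=> eq_alt.
have [c alt_gt0] : exists c, 0 < alternation c X := alternation_gt0 X0.
have [s [incs Xss sz_s]] := alternation_attained true X.
have [s' [incs' Xs' sz_s']] := alternation_attained false X.
have {c alt_gt0}gt0 : 0 < alternation true X by case: c alt_gt0; rewrite ?eq_alt.
case: s incs Xss sz_s => [|h s] incs Xss sz_s; first by rewrite -sz_s in gt0.
case: s' incs' Xs' sz_s' => [|h' s'] incs' Xs' sz_s'.
  by rewrite eq_alt -sz_s' in gt0.
have hX : (true, h) \in X by case/andP: Xss.
have h'X : (false, h') \in X by case/andP: Xs'.
have [lt_h|lt_h|/val_inj eq_h] := ltngtP h h'.
- have := @alternation_ge true X [:: h, h' & s'].
  rewrite /increasing /= lt_h hX => /(_ incs' Xs').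
  by rewrite eq_alt -sz_s' ltnn.
- have := @alternation_ge false X [:: h', h & s].
  rewrite /increasing /= lt_h h'X => /(_ incs Xss).
  by rewrite -eq_alt -sz_s ltnn.
by have /signedP/(_ _ _ hX)/negP := Xs; apply; rewrite eq_h.
Qed.

(** Absolute values are counted from 0, hence the predecessor. *)
Definition alt_label X : label :=
  (alternation false X < alternation true X,
   (maxn (alternation true X) (alternation false X)).-1).

Lemma alt_label_opp X :
  X != set0 -> signed X -> alt_label (set_opp X) = label_opp (alt_label X).
Proof.
move=> X0 Xs; rewrite /alt_label /label_opp !alternation_opp maxnC /= -leqNgt.
by rewrite ltn_neqAle alternation_neq.
Qed.

(** If both sets have the same maximal length, then the starting sign that
    attains it in X also does in Y, and no other one can. *)
Lemma alt_label_sub X Y : X != set0 -> signed Y -> X \subset Y ->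
  alt_label Y <> label_opp (alt_label X).
Proof.
move=> X0 Ys sXY; have Xs := signed_sub sXY Ys.
have Y0 : Y != set0 by apply: contraNneq X0 => Y0; rewrite -subset0 -Y0.
have := alternation_neq X0 Xs; have := alternation_neq Y0 Ys.
have := alternation_sub true sXY; have := alternation_sub false sXY.
have [[c cX] [c' cY]] := (alternation_gt0 X0, alternation_gt0 Y0).
have {c cX}: 0 < maxn (alternation true X) (alternation false X).
  by rewrite leq_max; case: c cX => ->; rewrite ?orbT.
have {c' cY}: 0 < maxn (alternation true Y) (alternation false Y).
  by rewrite leq_max; case: c' cY => ->; rewrite ?orbT.
rewrite /alt_label /label_opp /=.
move: (alternation true X) (alternation false X) => a a'.
move: (alternation true Y) (alternation false Y) => c c'.
move=> gtY gtX le' le neqY neqX [sgE /(congr1 S)]; rewrite !prednK // => maxE.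
have [lt_a|le_a] := ltnP a' a.
  have le_c : c <= c' by rewrite leqNgt sgE lt_a.
  rewrite (maxn_idPr le_c) (maxn_idPl (ltnW lt_a)) in maxE.
  by rewrite eqn_leq le_c maxE le in neqY.
have lt_c : c' < c by rewrite sgE -leqNgt.
rewrite (maxn_idPl (ltnW lt_c)) (maxn_idPr le_a) in maxE.
by rewrite eqn_leq (ltnW lt_c) maxE le' in neqY.
Qed.

End Alternating.

(** * Vertices and adjacency *)

Section Vertices.
Variables n k : nat.

Lemma KS_adj_sym b (A B : KS_vert n k) : KS_adj b A B = KS_adj b B A.
Proof.
rewrite /KS_adj; case: b; first by rewrite setIC.
by rewrite -set_opp_eq0 set_oppI set_oppK setIC.
Qed.

Lemma adj_KS b (A B : KS n k) : adj b A B <-> KS_adj b A B.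
Proof.
split=> [[e eE <-]|AB].
  have /existsP[A' /existsP[B' /andP[/eqP eAB' AB']]] := valP e.
  move: eE; rewrite /= /KS_ends {}eAB' /KS_sgn => eqS.
  have /set2P A'E : A' \in [set A; B] by rewrite -eqS set21.
  have /set2P B'E : B' \in [set A; B] by rewrite -eqS set22.
  have /set2P AE : A \in [set A'; B'] by rewrite eqS set21.
  have /set2P BE : B \in [set A'; B'] by rewrite eqS set22.
  case: A'E AE BE AB' => ->; case: B'E => -> AE BE //.
  - by case: BE => ->.
  - by rewrite KS_adj_sym.
  by case: AE => ->.
have ABe : [exists A', exists B',
    (([set A; B], b).1 == [set A'; B']) && KS_adj b A' B'].
  by apply/existsP; exists A; apply/existsP; exists B; rewrite eqxx.
by exists (Sub ([set A; B], b) ABe : KS_edge n k); rewrite /= /KS_ends /KS_sgn SubK.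
Qed.

Definition signed_set (v : SShat n k) : {set pm n} := val (val (val v)).

Lemma adj_SShat b (u v : SShat n k) :
  adj b u v <-> KS_adj b (val (val u)) (val (val v)).
Proof.
by split=> [/adj_induced/adj_induced/adj_KS|/adj_KS uv] //; do 2!apply/adj_induced.
Qed.

Lemma signed_set_inj : injective signed_set.
Proof. by move=> u v /val_inj/val_inj/val_inj. Qed.

Lemma signed_signed_set v : signed (signed_set v).
Proof. by have /andP[] := valP (val (val v)). Qed.

Lemma card_signed_set v : #|signed_set v| = k.
Proof. by have /andP[/eqP] := valP (val (val v)). Qed.

Hypothesis k_gt0 : 0 < k.

(** The least element of a set that alternates from - is negative, so the
    positivity condition excludes that case. *)
Lemma signed_setE v :
  exists s, [/\ increasing s, size s = k & signed_set v = alt_set false s].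
Proof.
apply/alternating_fromP.
have := valP v; have := valP (val v); rewrite !inE -/(signed_set v) => altv posv.
case/orP: altv => // /alternating_fromP[s [incs sz_s vE]].
case/existsP: posv => -[b c]; rewrite vE => /andP[+ /andP[/= bF /forallP least]].
case: s incs sz_s {vE} least => [|h s] incs sz_s least.
  by move: k_gt0; rewrite -sz_s.
rewrite inE mem_altseq ?increasing_uniq // => /= /andP[]; rewrite inE [h == c]eq_sym.
have [_ _|neq_ch cs _] /= := eqVneq c h; first by rewrite (negbTE bF).
have := least (true, h); rewrite inE /= inE eqxx leqNgt.
by rewrite (allP (order_path_min ltn_trans incs)) ?map_f.
Qed.

Lemma exists_vertex s : increasing s -> size s = k ->
  exists v, signed_set v = alt_set false s.
Proof.
move=> incs sz_s; set A := alt_set false s; have uns := increasing_uniq incs.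
have AS : signed_subset k A.
  apply/andP; split.
    have -> : A = [set (odd (index c s), c) | c in s].
      apply/setP=> -[b c]; rewrite inE mem_altseq //=.
      apply/andP/imsetP=> [[cs /eqP->]|[c' c's [-> ->]]]; [by exists c|by []].
    by rewrite card_imset ?(card_uniqP uns) ?sz_s // => c c' [].
  apply/signedP=> b c; rewrite !inE !mem_altseq //= => /andP[_ /eqP->].
  by rewrite andbC; case: (odd _).
pose A1 : KS n k := Sub A AS.
have A1alt : A1 \in [set A : KS n k | alternating k (val A)].
  by rewrite inE; apply/orP; left; apply/alternating_fromP; exists s.
pose A2 : SS n k := Sub A1 A1alt.
have A2pos : A2 \in [set A : SS n k | least_positive (val (val A))].
  rewrite inE /=; case: s {A1 A1alt A2 AS} @A incs sz_s uns => [|h s] A incs sz_s uns.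
    by move: k_gt0; rewrite -sz_s.
  apply/existsP; exists (false, h); rewrite !inE eqxx /=.
  apply/forallP=> -[b c]; apply/implyP; rewrite inE mem_altseq //= => /andP[+ _].
  rewrite inE => /predU1P[->|cs] //.
  by rewrite ltnW // (allP (order_path_min ltn_trans incs)) ?map_f.
by exists (Sub A2 A2pos).
Qed.

Definition coords (v : SShat n k) : {set 'I_n} := [set x.2 | x in signed_set v].

Lemma card_coords v : #|coords v| = k.
Proof.
rewrite card_in_imset ?card_signed_set // => -[b c] [b' c'] /= bv b'v cc'.
move: b'v; rewrite -{}cc' => b'v; congr pair.
have /signedP/(_ _ _ bv) := signed_signed_set v.
apply: contraNeq => neq_b; rewrite -(_ : b' = ~~ b) //.
by case: b b' neq_b {bv b'v} => [] [].
Qed.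

(** The increasing enumeration of the coordinates determines the signs. *)
Lemma coords_inj : injective coords.
Proof.
have coordsE s v : increasing s -> signed_set v = alt_set false s ->
    coords v =i s.
  move=> incs vE c; rewrite /coords vE; have uns := increasing_uniq incs.
  apply/imsetP/idP => [[x + ->]|cs]; first by rewrite inE mem_altseq // => /andP[].
  by exists (odd (index c s), c); rewrite // inE mem_altseq //= cs eqxx.
move=> u v eq_uv; apply: signed_set_inj.
have [s [incs _ uE]] := signed_setE u; have [s' [incs' _ vE]] := signed_setE v.
rewrite uE vE; congr alt_set; apply: (inj_map val_inj).
apply: (irr_sorted_eq ltn_trans ltnn) => //; apply: eq_mem_map => c.
by rewrite -(coordsE s u) // -(coordsE s' v) // eq_uv.
Qed.

End Vertices.

(** * Colouring by stars *)

(** The colour of v is some coordinate of v in J, and the sign of v is the sign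
    of that coordinate. *)
Lemma star_colouring n k (G : sgraph) (phi : G -> KS_vert n k) (J : {set 'I_n}) :
  (forall b u v, adj b u v -> KS_adj b (phi u) (phi v)) ->
  (forall v, exists2 x, x \in val (phi v) & x.2 \in J) ->
  balanced_colourable G #|J|.
Proof.
move=> phi_adj hitJ; apply/balanced_colourableP.
have /fin_all_exists[x xP] v : exists x, (x \in val (phi v)) && (x.2 \in J).
  by have [x xv xJ] := hitJ v; exists x; rewrite xv.
have xJ v : (x v).2 \in J by have /andP[] := xP v.
exists (fun v => enum_rank_in (xJ v) (x v).2), (fun v => (x v).1).
move=> b u v /phi_adj adj_uv /(congr1 enum_val); rewrite !enum_rankK_in // => eq_c.
have [/andP[xu _] /andP[xv _]] := (xP u, xP v).
move: adj_uv eq_c xu xv; case: (x u) (x v) => [c i] [c' i'] /= adj_uv <- xu xv.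
case: b adj_uv => /eqP/setP adj_uv.
  have := adj_uv (c, i); rewrite !inE xu /= => /negbT.
  by apply: contraNeq; case: c c' {xu} xv => [] [].
have := adj_uv (c, i); rewrite !inE xu in_set_opp /= => /negbT.
by apply: contraNeq; case: c c' {xu} xv => [] [].
Qed.

(** For use with [phi] the identity or the inclusion of a vertex-deleted
    subgraph. *)
Lemma star_colouring_SShat n k (G : sgraph) (phi : G -> SShat n k) (J : {set 'I_n}) :
  (forall b u v, adj b u v -> adj b (phi u) (phi v)) ->
  (forall v, ~~ (coords (phi v) \subset ~: J)) -> balanced_colourable G #|J|.
Proof.
move=> phi_adj hitJ.
apply: (@star_colouring n k G (fun v => val (val (phi v)))) => [b u v uv|v].
  exact/adj_SShat/phi_adj.
have /subsetPn[_ /imsetP[x xv ->]] := hitJ v.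
by rewrite inE negbK => xJ; exists x.
Qed.

(** * The lower bound *)

(** The labelling [lam] below feeds Tucker's lemma. Which vertex is picked inside
    X or -X does not matter, but X and -X must pick the same one; hence the
    condition [inner], which is symmetric under the antipode. *)
Lemma chi_b_lower_bound n k q : 0 < k -> k <= n ->
  balanced_colourable (SShat n k) q -> n - k + 1 <= q.
Proof.
move=> k_gt0 le_kn /balanced_colourableP[f [t ft]].
pose inside (X : {set pm n}) (v : SShat n k) := signed_set v \subset X.
pose inner X v := inside X v || inside (set_opp X) v.
pose lam X : label := if [pick v | inner X v] is Some v
  then (t v (+) ~~ inside X v, k.-1 + f v) else alt_label X.
have outside X v : signed X -> inner X v -> inside (set_opp X) v = ~~ inside X v.
  move=> Xs; rewrite /inner; have [Xv _|] := boolP (inside X v); last by [].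
  apply/negP=> oXv; have := signed_disjoint Xs Xv oXv.
  by rewrite setIid -cards_eq0 card_signed_set eqn0Ngt k_gt0.
have lam_opp X : X != set0 -> signed X -> lam (set_opp X) = label_opp (lam X).
  move=> X0 Xs; rewrite /lam.
  have -> : [pick v | inner (set_opp X) v] = [pick v | inner X v].
    by apply: eq_pick => v; rewrite /inner set_oppK orbC.
  case: pickP => [v Xv|_]; last exact: alt_label_opp.
  by rewrite /label_opp /= outside // negbK addbN negbK.
(* A long alternating sequence in X, cut down to k terms, is a vertex or the
   opposite of a vertex. *)
have no_inner X : inner X =1 xpred0 -> forall b, alternation b X < k.
  move=> noX b; rewrite ltnNge; apply/negP=> le_k.
  have [s [incs Xs sz_s]] := alternation_attained b X.
  have [v vE] : exists v : SShat n k, signed_set v = alt_set false (take k s).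
    apply: exists_vertex => //; last by rewrite size_takel // sz_s.
    by rewrite /increasing map_take take_sorted.
  have := all_altseq_take k Xs.
  have /negbT := noX v; rewrite /inner /inside vE negb_or => /andP[nX noX'].
  case: b {Xs sz_s le_k} => Xtake.
    case/negP: noX'; apply/subsetP=> x; rewrite inE; move: x; apply/allP.
    by rewrite all_altseq_opp.
  by case/negP: nX; apply/subsetP=> x; rewrite inE; move: x; apply/allP.
have small_alt X : X != set0 -> inner X =1 xpred0 -> (alt_label X).2 < k.-1.
  move=> X0 noX; have [b gt0] := alternation_gt0 X0.
  rewrite /= -ltnS !prednK //; first by rewrite gtn_max !no_inner.
  by rewrite leq_max; case: b gt0 => ->; rewrite ?orbT.
suff: n <= k.-1 + q.
  move=> le_n; rewrite addn1 -subSn // leq_subLR.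
  by rewrite -(prednK k_gt0) addSn ltnS.
apply: (octahedral_tucker lam_opp) => [X X0 Xs|X Y X0 Ys sXY]; rewrite /lam.
  case: pickP => [v _|noX] /=; first by rewrite ltn_add2l ltn_ord.
  by apply: leq_trans (leq_addr _ _); apply: small_alt.
have Xs := signed_sub sXY Ys.
have inside_sub v : inside X v -> inside Y v by move/subset_trans; apply.
have inside_opp_sub v : inside (set_opp X) v -> inside (set_opp Y) v.
  by move/subset_trans; apply; rewrite set_oppS.
have inner_sub v : inner X v -> inner Y v.
  by case/orP=> [/inside_sub|/inside_opp_sub] Yv; apply/orP; [left|right].
case: pickP => [w Yw|noY]; case: pickP => [v Xv|noX].
- rewrite /label_opp /= => -[sgE /addnI/val_inj eq_f].
  have Yv := inner_sub _ Xv.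
  have XYv : inside X v = inside Y v.
    apply/idP/idP=> [/inside_sub //|]; apply: contraLR.
    by rewrite -!outside // => /inside_opp_sub.
  (* v and w lie in Y or -Y, so they are joined by an edge of this sign. *)
  have vw : KS_adj (inside Y v (+) inside Y w) (val (val v)) (val (val w)).
    have Ys' : signed (set_opp Y) by rewrite signed_opp.
    have inO u : inner Y u -> inside Y u = false -> inside (set_opp Y) u.
      by move=> Yu Yu'; rewrite outside // Yu'.
    case inYv: (inside Y v); case inYw: (inside Y w); rewrite /KS_adj /=.
    + by apply: signed_disjoint Ys inYv _; rewrite set_oppS.
    + exact: signed_disjoint Ys inYv (inO _ Yw inYw).
    + by rewrite setIC; apply: signed_disjoint Ys inYw (inO _ Yv inYv).
    by apply: signed_disjoint Ys' (inO _ Yv inYv) _; rewrite set_oppS; apply: inO.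
  move/adj_SShat/ft/(_ (esym eq_f)): vw sgE; rewrite XYv.
  by case: (t v); case: (t w); case: (inside Y v); case: (inside Y w).
(* The two kinds of labels have different absolute values. *)
- move=> [_ eq_abs]; have := small_alt X X0 noX.
  by rewrite /= -eq_abs ltnNge leq_addr.
- by have := noY v; rewrite inner_sub.
exact: alt_label_sub.
Qed.

(** * The balanced chromatic number *)

Theorem theorem8 (n k : nat) (hk : 1 <= k) (hkn : k <= n) :
  is_chi_b (SShat n k) (n - k + 1) /\
  (forall A : SShat n k, balanced_colourable (delete (SShat n k) A) (n - k)).
Proof.
split=> [|A].
  split=> [|q]; last exact: chi_b_lower_bound.
  have le_m : n - k + 1 <= n.
    by rewrite addn1 -subSn // leq_subLR -addn1 addnC leq_add2r.
  (* A k-set cannot avoid n - k + 1 coordinates. *)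
  pose J := [set widen_ord le_m i | i : 'I_(n - k + 1)].
  have cardJ : #|J| = n - k + 1.
    by rewrite card_imset ?card_ord // => i i' /(congr1 val)/= /val_inj.
  rewrite -cardJ; apply: (star_colouring_SShat (phi := id)) => // v.
  apply/negP=> /subset_leq_card; rewrite card_coords // -(leq_add2l #|J|).
  by rewrite cardsC card_ord cardJ addn1 addSn subnK // ltnn.
have cardJ : #|~: coords A| = n - k.
  have /(congr1 (subn^~ k)) := cardsC (coords A).
  by rewrite card_ord card_coords // addKn.
rewrite -cardJ.
apply: (@star_colouring_SShat n k (delete (SShat n k) A) val) => [b u v|v].
  by move/adj_induced.
rewrite setCK; apply/negP=> sub_vA.
have := valP v; rewrite !inE => /eqP; apply; apply: (coords_inj hk).
by apply/eqP; rewrite eqEcard sub_vA !card_coords leqnn.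
Qed.
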